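(* Let $\mathcal{L}=(L,\vee,\wedge,',0,1)$ be an orthomodular lattice. Then $\mathbf{L}(\mathbf{N}(\mathcal{L}))=\mathcal{L}$.
   Context: An orthomodular lattice is an algebra $\mathcal{L}=(L,\vee,\wedge,',0,1)$ of type $(2,2,1,0,0)$ such that: (i) $(L,\vee,\wedge,0,1)$ is a bounded lattice (with least element $0$ and greatest element $1$); (ii) $x\le y$ implies $x'\ge y'$; (iii) $(x')'=x$; (iv) $x\le y$ implies $y=x\vee(y\wedge x')$. A right near semiring is an algebra $(R,+,\cdot,0,1)$ of type $(2,2,0,0)$ such that: (i) $(R,+,0)$ is a commutative monoid; (ii) $(R,\cdot)$ is a groupoid (a set with a binary operation, not necessarily associative) with two-sided neutral element $1$; (iii) $(x+y)z=xz+yz$ for all $x,y,z\in R$; (iv) $x0=0x=0$ for all $x\in R$. In a tuple $(R,\wedge,\ast,1,0)$ the additive operation is $\wedge$ with neutral element $1$, the multiplicative operation is $\ast$ with neutral element $0$, and the absorbing element in (iv) is $1$. A right near semiring $(R,+,\cdot,0,1)$ is $\vee$-semilattice ordered if there is a join-semilattice operation $\vee$ on $R$ such that $x+y=x\vee y$ and $xy\le y$ for all $x,y\in R$, with respect to the induced order ($x\le y$ iff $x\vee y=y$). It is $\wedge$-semilattice ordered if there is a meet-semilattice operation $\wedge$ on $R$ such that $x+y=x\wedge y$ and $xy\ge y$ for all $x,y\in R$, with respect to the induced order ($x\le y$ iff $x\wedge y=x$). A coupled right orthosemiring is an ordered triple $((R,\vee,\cdot,0,1),(R,\wedge,\ast,1,0),\alpha)$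 such that: (R1) $(R,\vee,\wedge)$ is a lattice; (R2) $(R,\vee,\cdot,0,1)$ is a $\vee$-semilattice ordered right near semiring; (R3) $(R,\wedge,\ast,1,0)$ is a $\wedge$-semilattice ordered right near semiring; (R4) $\alpha$ is an involutive isomorphism between $(R,\vee,\cdot,0,1)$ and $(R,\wedge,\ast,1,0)$, i.e. $\alpha:R\to R$ satisfies $\alpha(\alpha(x))=x$, $\alpha(x\vee y)=\alpha(x)\wedge\alpha(y)$, $\alpha(xy)=\alpha(x)\ast\alpha(y)$ for all $x,y\in R$, and $\alpha(0)=1$, $\alpha(1)=0$; (R5) $(x\wedge\alpha(y))\vee y=x\ast y$ for all $x,y\in R$; (R6) $y\ast(x\wedge y)=y$ for all $x,y\in R$. For an orthomodular lattice $\mathcal{L}=(L,\vee,\wedge,',0,1)$, put $x\oplus y:=(x\wedge y')\vee y$ and $x\odot y:=(x\vee y')\wedge y$ for $x,y\in L$, and let $\mathbf{N}(\mathcal{L}):=((L,\vee,\odot,0,1),(L,\wedge,\oplus,1,0),{}')$; this is a coupled right orthosemiring. For a coupled right orthosemiring $\mathcal{N}=((R,\vee,\cdot,0,1),(R,\wedge,\ast,1,0),\alpha)$, let $\mathbf{L}(\mathcal{N}):=(R,\vee,\wedge,\alpha,0,1)$; this is an orthomodular lattice. *)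

(* Defs.v *)
(* Plain Rocq: algebras are types with operations and Leibniz equality. *)
From Stdlib Require Import Setoid.

Record is_lattice (A : Type) (join meet : A -> A -> A) : Prop := {
  lat_joinA : forall x y z, join x (join y z) = join (join x y) z;
  lat_joinC : forall x y, join x y = join y x;
  lat_meetA : forall x y z, meet x (meet y z) = meet (meet x y) z;
  lat_meetC : forall x y, meet x y = meet y x;
  lat_joinK : forall x y, join x (meet x y) = x;
  lat_meetK : forall x y, meet x (join x y) = x
}.

Record is_semilattice (A : Type) (op : A -> A -> A) : Prop := {
  sl_assoc : forall x y z, op x (op y z) = op (op x y) z;
  sl_comm : forall x y, op x y = op y x;
  sl_idem : forall x, op x x = x
}.

Definition join_le (A : Type) (join : A -> A -> A) (x y : A) : Prop :=
  join x y = y.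

Definition meet_le (A : Type) (meet : A -> A -> A) (x y : A) : Prop :=
  meet x y = x.

Arguments join_le {A} join x y.
Arguments meet_le {A} meet x y.

Record is_orthomodular_lattice (A : Type) (join meet : A -> A -> A)
    (compl : A -> A) (zero one : A) : Prop := {
  oml_lattice : is_lattice A join meet;
  oml_bot : forall x, join_le join zero x;
  oml_top : forall x, join_le join x one;
  oml_anti : forall x y, join_le join x y -> join_le join (compl y) (compl x);
  oml_invol : forall x, compl (compl x) = x;
  oml_orthomod : forall x y,
    join_le join x y -> y = join x (meet y (compl x))
}.

(* The multiplication is not assumed associative, nor left distributive. *)
Record is_right_near_semiring (A : Type) (add mul : A -> A -> A)
    (zero one : A) : Prop := {
  rns_addA : forall x y z, add x (add y z) = add (add x y) z;
  rns_addC : forall x y, add x y = add y x;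
  rns_add0l : forall x, add zero x = x;
  rns_mul1l : forall x, mul one x = x;
  rns_mul1r : forall x, mul x one = x;
  rns_mulDl : forall x y z, mul (add x y) z = add (mul x z) (mul y z);
  rns_mul0r : forall x, mul x zero = zero;
  rns_mul0l : forall x, mul zero x = zero
}.

Definition is_join_ordered_rns (A : Type) (add mul : A -> A -> A)
    (zero one : A) : Prop :=
  is_right_near_semiring A add mul zero one /\
  exists join : A -> A -> A,
    is_semilattice A join /\
    (forall x y, add x y = join x y) /\
    (forall x y, join_le join (mul x y) y).

Definition is_meet_ordered_rns (A : Type) (add mul : A -> A -> A)
    (zero one : A) : Prop :=
  is_right_near_semiring A add mul zero one /\
  exists meet : A -> A -> A,
    is_semilattice A meet /\
    (forall x y, add x y = meet x y) /\
    (forall x y, meet_le meet y (mul x y)).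

(* Isomorphism from (A, add1, mul1, zero1, one1) to (A, add2, mul2, zero2, one2);
   bijectivity follows from the involution law. *)
Record is_involutive_iso (A : Type)
    (add1 mul1 : A -> A -> A) (zero1 one1 : A)
    (add2 mul2 : A -> A -> A) (zero2 one2 : A) (alpha : A -> A) : Prop := {
  iso_invol : forall x, alpha (alpha x) = x;
  iso_add : forall x y, alpha (add1 x y) = add2 (alpha x) (alpha y);
  iso_mul : forall x y, alpha (mul1 x y) = mul2 (alpha x) (alpha y);
  iso_zero : alpha zero1 = zero2;
  iso_one : alpha one1 = one2
}.

(* The triple ((A, join, mul, zero, one), (A, meet, ast, one, zero), alpha):
   in the second algebra [one] is additively neutral and multiplicatively
   absorbing, and [zero] is multiplicatively neutral. *)
Record is_coupled_right_orthosemiring (A : Type)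
    (join mul : A -> A -> A) (zero one : A)
    (meet ast : A -> A -> A) (alpha : A -> A) : Prop := {
  cro_R1 : is_lattice A join meet;
  cro_R2 : is_join_ordered_rns A join mul zero one;
  cro_R3 : is_meet_ordered_rns A meet ast one zero;
  cro_R4 : is_involutive_iso A join mul zero one meet ast one zero alpha;
  cro_R5 : forall x y, join (meet x (alpha y)) y = ast x y;
  cro_R6 : forall x y, ast y (meet x y) = y
}.

Record orthomodular_lattice : Type := OrthomodularLattice {
  ol_carrier : Type;
  ol_join : ol_carrier -> ol_carrier -> ol_carrier;
  ol_meet : ol_carrier -> ol_carrier -> ol_carrier;
  ol_compl : ol_carrier -> ol_carrier;
  ol_zero : ol_carrier;
  ol_one : ol_carrier;
  ol_axioms :
    is_orthomodular_lattice ol_carrier ol_join ol_meet ol_compl ol_zero ol_one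
}.

Record coupled_right_orthosemiring : Type := CoupledRightOrthosemiring {
  cs_carrier : Type;
  cs_join : cs_carrier -> cs_carrier -> cs_carrier;
  cs_mul : cs_carrier -> cs_carrier -> cs_carrier;
  cs_zero : cs_carrier;
  cs_one : cs_carrier;
  cs_meet : cs_carrier -> cs_carrier -> cs_carrier;
  cs_ast : cs_carrier -> cs_carrier -> cs_carrier;
  cs_alpha : cs_carrier -> cs_carrier;
  cs_axioms :
    is_coupled_right_orthosemiring cs_carrier cs_join cs_mul cs_zero cs_one
      cs_meet cs_ast cs_alpha
}.

Definition ol_oplus (L : orthomodular_lattice) (x y : ol_carrier L) :
    ol_carrier L :=
  ol_join L (ol_meet L x (ol_compl L y)) y.

Definition ol_odot (L : orthomodular_lattice) (x y : ol_carrier L) :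
    ol_carrier L :=
  ol_meet L (ol_join L x (ol_compl L y)) y.

Section LatticeFacts.

Variables (A : Type) (join meet : A -> A -> A).
Hypothesis lat : is_lattice A join meet.

Lemma lattice_joinI x : join x x = x.
Proof.
rewrite <- (lat_meetK _ _ _ lat x x) at 2. apply (lat_joinK _ _ _ lat).
Qed.

Lemma lattice_meetI x : meet x x = x.
Proof.
rewrite <- (lat_joinK _ _ _ lat x x) at 2. apply (lat_meetK _ _ _ lat).
Qed.

Lemma lattice_join_meet x y : join x y = y -> meet x y = x.
Proof. intros H. rewrite <- H. apply (lat_meetK _ _ _ lat). Qed.

Lemma lattice_meet_join x y : meet x y = x -> join x y = y.
Proof.
intros H. rewrite <- H, (lat_meetC _ _ _ lat), (lat_joinC _ _ _ lat).
apply (lat_joinK _ _ _ lat).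
Qed.

Lemma lattice_join_semilattice : is_semilattice A join.
Proof.
split; [apply (lat_joinA _ _ _ lat) | apply (lat_joinC _ _ _ lat)
       | apply lattice_joinI].
Qed.

Lemma lattice_meet_semilattice : is_semilattice A meet.
Proof.
split; [apply (lat_meetA _ _ _ lat) | apply (lat_meetC _ _ _ lat)
       | apply lattice_meetI].
Qed.

Lemma lattice_meet_lb x y : join (meet x y) y = y.
Proof.
rewrite (lat_joinC _ _ _ lat), (lat_meetC _ _ _ lat).
apply (lat_joinK _ _ _ lat).
Qed.

Lemma lattice_join_ub x y : join x (join x y) = join x y.
Proof. now rewrite (lat_joinA _ _ _ lat), lattice_joinI. Qed.

Lemma lattice_join_lub x y z : join x z = z -> join y z = z ->
  join (join x y) z = z.
Proof. intros H1 H2. now rewrite <- (lat_joinA _ _ _ lat), H2, H1. Qed.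

Lemma lattice_meet_glb x y z : join z x = x -> join z y = y ->
  join z (meet x y) = meet x y.
Proof.
intros H1 H2. apply lattice_meet_join.
rewrite (lat_meetA _ _ _ lat), (lattice_join_meet _ _ H1).
now apply lattice_join_meet.
Qed.

Lemma lattice_le_anti x y : join x y = y -> join y x = x -> x = y.
Proof. intros H1 H2. now rewrite <- H1, (lat_joinC _ _ _ lat). Qed.

End LatticeFacts.

Section OrthomodularFacts.

Variable L : orthomodular_lattice.

Local Notation "x \/' y" := (ol_join L x y) (at level 50, left associativity).
Local Notation "x /\' y" := (ol_meet L x y) (at level 40, left associativity).
Local Notation c := (ol_compl L).
Local Notation O := (ol_zero L).
Local Notation I := (ol_one L).

Let ax := ol_axioms L.
Let lat := oml_lattice _ _ _ _ _ _ ax.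
Let joinA := lat_joinA _ _ _ lat.
Let joinC := lat_joinC _ _ _ lat.
Let meetA := lat_meetA _ _ _ lat.
Let meetC := lat_meetC _ _ _ lat.
Let cK := oml_invol _ _ _ _ _ _ ax.
Let anti := oml_anti _ _ _ _ _ _ ax.
Let join0 := oml_bot _ _ _ _ _ _ ax.
Let join1 := oml_top _ _ _ _ _ _ ax.
Let orthomod := oml_orthomod _ _ _ _ _ _ ax.

Lemma ol_compl_join x y : c (x \/' y) = c x /\' c y.
Proof.
apply (lattice_le_anti _ _ _ lat).
- apply (lattice_meet_glb _ _ _ lat); apply anti; unfold join_le.
  + apply (lattice_join_ub _ _ _ lat).
  + rewrite (joinC x y). apply (lattice_join_ub _ _ _ lat).
- rewrite <- (cK (c x /\' c y)). apply anti. unfold join_le.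
  apply (lattice_join_lub _ _ _ lat).
  + rewrite <- (cK x) at 1. apply anti. unfold join_le. rewrite meetC.
    apply (lattice_meet_lb _ _ _ lat).
  + rewrite <- (cK y) at 1. apply anti. apply (lattice_meet_lb _ _ _ lat).
Qed.

Lemma ol_compl_meet x y : c (x /\' y) = c x \/' c y.
Proof. now rewrite <- (cK (c x \/' c y)), ol_compl_join, !cK. Qed.

Lemma ol_meet1 x : x /\' I = x.
Proof. apply (lattice_join_meet _ _ _ lat), join1. Qed.

Lemma ol_meet0 x : O /\' x = O.
Proof. apply (lattice_join_meet _ _ _ lat), join0. Qed.

Lemma ol_compl0 : c O = I.
Proof.
apply (lattice_le_anti _ _ _ lat); [apply join1 |].
rewrite <- (cK I) at 1. apply anti. apply join0.
Qed.

Lemma ol_compl1 : c I = O.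
Proof. now rewrite <- ol_compl0, cK. Qed.

Lemma ol_join_compl x : x \/' c x = I.
Proof.
rewrite (orthomod x I (join1 x)) at 1. now rewrite (meetC I), ol_meet1.
Qed.

Lemma ol_meet_compl x : x /\' c x = O.
Proof.
now rewrite <- (cK (x /\' c x)), ol_compl_meet, ol_join_compl, ol_compl1.
Qed.

Lemma ol_dual_orthomod x y : x \/' y = y -> (c y \/' x) /\' y = x.
Proof.
intros H. apply anti in H. apply orthomod in H. rewrite cK in H.
apply (f_equal c) in H. rewrite ol_compl_join, ol_compl_meet, !cK in H.
now rewrite meetC, (joinC (c y)).
Qed.

Lemma ol_compl_oplus x y : c (ol_oplus L x y) = ol_odot L (c x) (c y).
Proof.
unfold ol_oplus, ol_odot. now rewrite ol_compl_join, ol_compl_meet.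
Qed.

Lemma ol_compl_odot x y : c (ol_odot L x y) = ol_oplus L (c x) (c y).
Proof.
unfold ol_oplus, ol_odot. now rewrite ol_compl_meet, ol_compl_join.
Qed.

Lemma ol_odotDl x y z :
  ol_odot L (x \/' y) z = ol_odot L x z \/' ol_odot L y z.
Proof.
unfold ol_odot.
set (u := (x \/' c z) /\' z). set (v := (y \/' c z) /\' z).
assert (E : forall t, t \/' c z = c z \/' ((t \/' c z) /\' z)).
{ intros t. rewrite <- (cK z) at 4. apply orthomod. unfold join_le.
  rewrite (joinC t). apply (lattice_join_ub _ _ _ lat). }
assert (F : (x \/' y) \/' c z = c z \/' (u \/' v)).
{ transitivity ((x \/' c z) \/' (y \/' c z)).
  - rewrite (joinC y (c z)), <- (joinA x (c z)), (joinA (c z) (c z)).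
    now rewrite (lattice_joinI _ _ _ lat), (joinC (c z) y), joinA.
  - rewrite (E x), (E y). fold u v.
    rewrite (joinC (c z) u), <- (joinA u (c z)), (joinA (c z) (c z)).
    now rewrite (lattice_joinI _ _ _ lat), joinA, (joinC u), <- joinA. }
rewrite F. apply ol_dual_orthomod.
apply (lattice_join_lub _ _ _ lat); apply (lattice_meet_lb _ _ _ lat).
Qed.

Lemma ol_oplusDl x y z :
  ol_oplus L (x /\' y) z = ol_oplus L x z /\' ol_oplus L y z.
Proof.
rewrite <- (cK (ol_oplus L (x /\' y) z)), ol_compl_oplus, ol_compl_meet.
rewrite ol_odotDl, ol_compl_join, !ol_compl_odot. now rewrite !cK.
Qed.

Lemma ol_odot_rns :
  is_right_near_semiring (ol_carrier L) (ol_join L) (ol_odot L) O I.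
Proof.
split; try assumption; unfold ol_odot; intros.
- rewrite joinC, join1. now rewrite meetC, ol_meet1.
- now rewrite ol_compl1, joinC, join0, ol_meet1.
- apply ol_odotDl.
- now rewrite meetC, ol_meet0.
- now rewrite join0, meetC, ol_meet_compl.
Qed.

Lemma ol_oplus_rns :
  is_right_near_semiring (ol_carrier L) (ol_meet L) (ol_oplus L) I O.
Proof.
split; try assumption; unfold ol_oplus; intros.
- now rewrite meetC, ol_meet1.
- now rewrite ol_meet0, join0.
- now rewrite ol_compl0, ol_meet1, joinC, join0.
- apply ol_oplusDl.
- apply join1.
- now rewrite meetC, ol_meet1, joinC, ol_join_compl.
Qed.

Lemma N_of_axioms :
  is_coupled_right_orthosemiring (ol_carrier L)
    (ol_join L) (ol_odot L) O I (ol_meet L) (ol_oplus L) (ol_compl L).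
Proof.
split.
- exact lat.
- split; [exact ol_odot_rns |]. exists (ol_join L). split; [| split].
  + exact (lattice_join_semilattice _ _ _ lat).
  + reflexivity.
  + intros x y. apply (lattice_meet_lb _ _ _ lat).
- split; [exact ol_oplus_rns |]. exists (ol_meet L). split; [| split].
  + exact (lattice_meet_semilattice _ _ _ lat).
  + reflexivity.
  + intros x y. unfold meet_le, ol_oplus. rewrite joinC.
    apply (lat_meetK _ _ _ lat).
- split.
  + exact cK.
  + exact ol_compl_join.
  + exact ol_compl_odot.
  + exact ol_compl0.
  + exact ol_compl1.
- reflexivity.
- intros x y. unfold ol_oplus. rewrite joinC. symmetry. apply orthomod.
  apply (lattice_meet_lb _ _ _ lat).
Qed.

End OrthomodularFacts.

Lemma L_of_axioms (S : coupled_right_orthosemiring) :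
  is_orthomodular_lattice (cs_carrier S) (cs_join S) (cs_meet S) (cs_alpha S)
    (cs_zero S) (cs_one S).
Proof.
destruct S as [A join mul zero one meet ast alpha ax]; simpl.
destruct ax as [lat [r2 _] [r3 _] r4 r5 r6].
split; unfold join_le.
- exact lat.
- exact (rns_add0l _ _ _ _ _ r2).
- intros x. apply (lattice_meet_join _ _ _ lat).
  rewrite (lat_meetC _ _ _ lat). apply (rns_add0l _ _ _ _ _ r3).
- intros x y H. apply (lattice_meet_join _ _ _ lat).
  rewrite (lat_meetC _ _ _ lat).
  rewrite <- (iso_add _ _ _ _ _ _ _ _ _ _ r4). now rewrite H.
- exact (iso_invol _ _ _ _ _ _ _ _ _ _ r4).
- intros x y H. apply (lattice_join_meet _ _ _ lat) in H.
  generalize (r6 x y). rewrite H, <- r5, (lat_joinC _ _ _ lat).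
  intros E. now symmetry.
Qed.

Definition N_of (L : orthomodular_lattice) : coupled_right_orthosemiring :=
  CoupledRightOrthosemiring (ol_carrier L)
    (ol_join L) (ol_odot L) (ol_zero L) (ol_one L)
    (ol_meet L) (ol_oplus L) (ol_compl L) (N_of_axioms L).

Definition L_of (S : coupled_right_orthosemiring) : orthomodular_lattice :=
  OrthomodularLattice (cs_carrier S) (cs_join S) (cs_meet S) (cs_alpha S)
    (cs_zero S) (cs_one S) (L_of_axioms S).

(* Main.v *)
Require Import Defs.
From Stdlib Require Import ProofIrrelevance.

(** [N_of] keeps the join, meet, complement and bounds and only adjoins the derived products
    [ol_odot] and [ol_oplus]; [L_of] forgets these products and reads the complement back from
    [cs_alpha]. Only the axiom proof is rebuilt, by [L_of_axioms], and proof irrelevance identifies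
    it with the original one. *)

Theorem theorem11 (L : orthomodular_lattice) : L_of (N_of L) = L.
Proof.
(* The operations agree by computation; the two structures differ only in
   their proofs of the axioms. *)
destruct L as [A join meet compl zero one ax].
exact (f_equal (OrthomodularLattice A join meet compl zero one)
         (proof_irrelevance _ _ ax)).
Qed.
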